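(* Let $R$ be a semiring, $V$ an $R$-module, and $D\subset W$ submodules of $V$. Assume that $T$ and $U$ are $D$-complements of $W$ in $V$ and that $D$ is summand absorbing in $W$. Then $T=U$.
   Context: $R$-module means left (semi)module over a semiring $R$ with $0$ and $1$; no subtraction is assumed. $D\subset W$ is summand absorbing in $W$ if for all $x,y\in W$, $x+y\in D$ implies $x\in D$ and $y\in D$. For submodules $D\subset W$ of $V$, a submodule $T$ of $V$ is a $D$-complement of $W$ in $V$ if $W+T=V$, $W\cap T=D$, and $(w+T)\cap T=\emptyset$ for every $w\in W\setminus D$. *)

(* Defs.v *)
From HB Require Import structures.
From mathcomp Require Import all_boot all_order all_algebra.
From mathcomp Require Import classical_sets.

Set Implicit Arguments.
Unset Strict Implicit.
Unset Printing Implicit Defensive.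

Import GRing.Theory.
Local Open Scope classical_set_scope.
Local Open Scope ring_scope.

(* Subsets of V are arbitrary (Prop-valued) sets; [in D] is the classical
   boolean membership predicate expected by the library's closure notions. *)
Definition submodule (R : pzSemiRingType) (V : lSemiModType R) (D : set V)
  : Prop := GRing.subsemimod_closed [in D].

Definition summand_absorbing (R : pzSemiRingType) (V : lSemiModType R)
  (D W : set V) : Prop :=
  forall x y : V, W x -> W y -> D (x + y) -> D x /\ D y.

Definition is_complement (R : pzSemiRingType) (V : lSemiModType R)
  (D W T : set V) : Prop :=
  [/\ submodule T,
      [set w + t | w in W & t in T] = [set: V],
      W `&` T = D
    & forall w : V, (W `\` D) w -> [set w + t | t in T] `&` T = set0].

(* Main.v *)
(** Decompose [t] in [T] along [W + U = V] and then its [U]-part along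
    [W + T = V]: [t = w + u = (w + w') + t'].  As [t] lies in [T], the sum
    [w + w'] cannot lie outside [D]; since [D] is summand absorbing in [W],
    [w] lies in [D], which is contained in [U], so [t = w + u] lies in [U]. *)
Require Import Defs.
From mathcomp Require Import all_boot all_order all_algebra.
From mathcomp Require Import boolp classical_sets.

Local Open Scope classical_set_scope.
Local Open Scope ring_scope.

(** Transfers additive closure from the boolean predicate [[in D]] to the [Prop]-valued set [D]. *)
Lemma submoduleD (R : pzSemiRingType) (V : lSemiModType R) (D : set V)
  (x y : V) : submodule D -> D x -> D y -> D (x + y).
Proof.
move=> [[_ DD] _] Dx Dy; have /set_mem := DD x y (mem_set Dx) (mem_set Dy).
exact.
Qed.

Lemma complement_subset (R : pzSemiRingType) (V : lSemiModType R)
  (D W T U : set V) :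
  submodule W -> is_complement D W T -> is_complement D W U ->
  summand_absorbing D W -> T `<=` U.
Proof.
move=> hW [_ WT _ disjT] [hU WU WUD _] habs t Tt.
have [w Ww [u Uu tE]] : [set w + u | w in W & u in U] t by rewrite WU.
have [w' Ww' [t' Tt' uE]] : [set w + t | w in W & t in T] u by rewrite WT.
have Dww' : D (w + w').
  apply: contrapT => nD.
  (* By associativity [t = (w + w') + t'], a common point of [(w + w') + T] and [T]; these are
     disjoint once [w + w'] is in [W] but not in [D]. *)
  have : ([set w + w' + s | s in T] `&` T) t.
    by split=> //; exists t' => //; rewrite -GRing.addrA uE.
  by rewrite disjT //; split=> //; apply: submoduleD.
have [Dw _] := habs _ _ Ww Ww' Dww'.
have [_ Uw] : (W `&` U) w by rewrite WUD.
by rewrite -tE; apply: submoduleD.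
Qed.

Theorem theorem6p5 (R : pzSemiRingType) (V : lSemiModType R)
  (D W T U : set V)
  (hD : submodule D) (hW : submodule W) (hDW : D `<=` W)
  (hT : is_complement D W T) (hU : is_complement D W U)
  (habs : summand_absorbing D W) :
  T = U.
(* The hypotheses are symmetric in [T] and [U], so one inclusion yields the other. *)
Proof. by apply/seteqP; split; apply: complement_subset habs. Qed.
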